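(* Let $(X,\rho_1)$ be a weighted space, let $q:X\to q(X)$ be a (surjective) continuous map from $(X,\rho_1)$ to the weighted space $(q(X),\rho_2)$, and let $P^{(1)}=(P^{(1)}_t)_{t\ge 0}$ be a generalized Feller semigroup acting on $\mathcal{B}^{\rho_1}(X)$. Assume that $\rho_2\circ q\le\rho_1$ on $X$. Let $D$ be a dense subspace of $\mathcal{B}^{\rho_2}(q(X))$. Assume furthermore that for every $f\in D$ and every $t\ge 0$ there is some $g\in\mathcal{B}^{\rho_2}(q(X))$ such that $$P^{(1)}_t(f\circ q)=g\circ q,$$ and additionally that there is a constant $C\ge 1$ such that for every $t\ge 0$ $$P^{(1)}_t(\rho_2\circ q)\le C\,\rho_2\circ q .$$ Then there is a generalized Feller semigroup $P^{(2)}=(P^{(2)}_t)_{t\ge0}$ acting on $\mathcal{B}^{\rho_2}(q(X))$ such that $$P^{(1)}_t(f\circ q)=(P^{(2)}_tf)\circ q$$ for all $f\in\mathcal{B}^{\rho_2}(q(X))$ and $t\ge 0$.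
   Context: A weighted space $(X,\rho)$ is a completely regular Hausdorff topological space $X$ together with an admissible weight function, i.e. a function $\rho:X\to(0,\infty)$ such that $K_R=\{x\in X:\rho(x)\le R\}$ is compact and separable for every $R>0$. Let $\mathrm{B}^\rho(X)$ be the Banach space of functions $f:X\to\mathbb{R}$ with $\|f\|_\rho:=\sup_{x\in X}\rho(x)^{-1}|f(x)|<\infty$, and let $\mathcal{B}^\rho(X)$ be the closure of the bounded continuous functions $C_b(X)$ in $\mathrm{B}^\rho(X)$. A family of bounded linear operators $P_t:\mathcal{B}^\rho(X)\to\mathcal{B}^\rho(X)$, $t\ge0$, is a generalized Feller semigroup if (F1) $P_0=I$; (F2) $P_{t+s}=P_tP_s$ for all $t,s\ge0$; (F3) $\lim_{t\to0}P_tf(x)=f(x)$ for all $f\in\mathcal{B}^\rho(X)$, $x\in X$; (F4) there are $C\in\mathbb{R}$ and $\varepsilon>0$ with $\|P_t\|_{L(\mathcal{B}^\rho(X))}\le C$ for all $t\in[0,\varepsilon]$; (F5) $P_tf\ge0$ whenever $f\in\mathcal{B}^\rho(X)$, $f\ge0$. By the Riesz representation theorem for $\mathcal{B}^\rho(X)$, for each $x\in X$ and $t\ge 0$ the positive functional $f\mapsto P_tf(x)$ is given by integration against a finite Radon measure $p_t(x,\cdot)$ with $\int\rho\,dp_t(x,\cdot)<\infty$; for nonnegative measurable functions $g\le\rho$ (such as $\rho_2\circ q$) not necessarily in $\mathcal{B}^{\rho}(X)$, $P_tg(x)$ is understood as $\int g(y)\,p_t(x,dy)$. *)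

(* Defs.v *)
From HB Require Import structures.
From mathcomp Require Import all_boot all_order all_algebra.
From mathcomp Require Import all_classical all_reals all_analysis.

Set Implicit Arguments.
Unset Strict Implicit.
Unset Printing Implicit Defensive.

Import Order.TTheory GRing.Theory Num.Theory.
Import numFieldNormedType.Exports.
Local Open Scope classical_set_scope.
Local Open Scope ring_scope.

Definition separable_set {X : topologicalType} (A : set X) : Prop :=
  exists2 S : set X, countable S & S `<=` A /\ A `<=` closure S.

Record weighted_space {R : realType} (X : topologicalType) (rho : X -> R)
    : Prop := WeightedSpace {
  weighted_hausdorff : hausdorff_space X ;
  weighted_completely_regular : completely_regular_space X ;
  weight_gt0 : forall x, 0 < rho x ;
  weight_compact : forall r, 0 < r -> compact [set x | rho x <= r] ;
  weight_separable : forall r, 0 < r -> separable_set [set x | rho x <= r] }.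

Section WeightedFunctions.
Context {R : realType} {X : topologicalType} (rho : X -> R).
Implicit Types (f g : X -> R) (A : set (X -> R)).

Definition weighted_range f : set R := range (fun x => (rho x)^-1 * `|f x|).

(* Meaningful on Brho only: sup of a set that is unbounded above is 0. *)
Definition wnorm f : R := sup (weighted_range f).

Definition Brho : set (X -> R) := [set f | has_ubound (weighted_range f)].

(* Closure of A in the normed space Brho. *)
Definition wclosure A : set (X -> R) :=
  [set f | Brho f /\
    forall e, 0 < e -> exists g, [/\ A g, Brho g & wnorm (f \- g) < e]].

Definition Cb : set (X -> R) := [set f | continuous f /\ bounded_fun f].

Definition calB : set (X -> R) := wclosure Cb.

(* Operators on calB are maps on all functions X -> R, of which only the
   values on calB matter.  The real-valued sup is the operator norm provided T
   is bounded. *)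
Definition opnorm (T : (X -> R) -> (X -> R)) : R :=
  sup [set wnorm (T f) | f in [set f | calB f /\ wnorm f <= 1]].

Definition bounded_linear_op (T : (X -> R) -> (X -> R)) : Prop :=
  [/\ forall f, calB f -> calB (T f),
      forall (a : R) f g, calB f -> calB g ->
        T (fun x => a * f x + g x) = (fun x => a * T f x + T g x) &
      exists M : R, forall f, calB f -> wnorm (T f) <= M * wnorm f].

Record generalized_feller (P : R -> (X -> R) -> (X -> R)) : Prop :=
  GeneralizedFeller {
  feller_op : forall t, 0 <= t -> bounded_linear_op (P t) ;
  feller0 : forall f, calB f -> P 0 f = f ;
  fellerD : forall t s, 0 <= t -> 0 <= s ->
    forall f, calB f -> P (t + s) f = P t (P s f) ;
  feller_cvg : forall f x, calB f -> P t f x @[t --> 0^'+] --> f x ;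
  feller_bounded : exists C e : R, 0 < e /\
    forall t, 0 <= t <= e -> opnorm (P t) <= C ;
  feller_ge0 : forall t f, 0 <= t -> calB f ->
    (forall x, 0 <= f x) -> forall x, 0 <= P t f x }.

Definition linear_subspace (D : set (X -> R)) : Prop :=
  D (fun=> 0) /\
  forall (a : R) f g, D f -> D g -> D (fun x => a * f x + g x).

Definition dense_subspace (D : set (X -> R)) : Prop :=
  [/\ D `<=` calB, linear_subspace D & calB `<=` wclosure D].

End WeightedFunctions.

Definition borel (X : ptopologicalType) := g_sigma_algebraType (@open X).

Section Representation.
Context {R : realType} {X : ptopologicalType}.
Local Open Scope ereal_scope.

Definition finite_radon (mu : {measure set (borel X) -> \bar R}) : Prop :=
  mu setT < +oo /\
  forall A : set (borel X), measurable A ->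
    mu A = ereal_sup [set mu K | K in [set K : set X | compact K /\ K `<=` A]].

(* The measure representing the functional ell on calB rho.  For a weighted
   space and a positive bounded linear ell it exists and is unique, by the Riesz
   representation theorem.  The integral of f converges absolutely, as
   `|f| <= wnorm rho f * rho. *)
Definition riesz_measure (rho : X -> R) (ell : (X -> R) -> R)
    (mu : {measure set (borel X) -> \bar R}) : Prop :=
  [/\ finite_radon mu,
      \int[mu]_y (rho y)%:E < +oo &
      forall f, calB rho f -> (ell f)%:E = \int[mu]_y (f y)%:E].

(* P_t g <= h pointwise, for g nonnegative and measurable but not necessarily in
   calB rho: P_t g x is the integral of g against the measure p_t(x, .)
   representing f |-> P_t f x. *)
Definition extended_le (rho : X -> R) (T : (X -> R) -> (X -> R))
    (g h : X -> R) : Prop :=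
  forall (x : X) (p : {measure set (borel X) -> \bar R}),
    riesz_measure rho (fun f => T f x) p -> \int[p]_y (g y)%:E <= (h x)%:E.

End Representation.

(* Main.v *)
Require Import Defs.
From HB Require Import structures.
From mathcomp Require Import all_boot all_order all_algebra.
From mathcomp Require Import all_classical all_reals all_analysis.
From mathcomp Require Import measurable_realfun lra.
Set Implicit Arguments.
Unset Strict Implicit.
Unset Printing Implicit Defensive.
Import Order.TTheory GRing.Theory Num.Theory.
Import numFieldNormedType.Exports.
Local Open Scope classical_set_scope.
Local Open Scope ring_scope.

(** Write [||f||] for the weighted norm. The theorem follows from one estimate:
    for [f] in [calB rho2],

      [`|P1 t (f \o q) x| <= C * ||f|| * rho2 (q x)]   for all [x],

    obtained by integrating [`|f \o q| <= ||f|| * (rho2 \o q)] against the measure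
    that represents [h |-> P1 t h x]. If [f] is approximated by [d] in [D], then
    [P1 t (d \o q) = g \o q] and the estimate for [f - d] shows that
    [P1 t (f \o q)] is within a small multiple of [rho2 \o q] of [g \o q]. Hence
    [P1 t (f \o q)] is constant on the fibres of [q] and descends to a function on
    [Y] that is a limit of elements of [calB rho2]. This function is [P2 t f]; the
    semigroup law, positivity and pointwise continuity are inherited from [P1],
    and the operator norms are at most [C].

    The assumption on [P1 t (rho2 \o q)] speaks of every measure representing
    [h |-> P1 t h x], so it is of use only once such a measure is known to exist.
    Most of the text therefore proves the Riesz representation theorem for a
    positive bounded functional [ell] on [calB rho] ([riesz_measure_exists]). The
    mass of an open set [U] is the supremum of [ell u] over continuous [u] between
    [0] and the indicator of [U], and the outer measure of a set is the infimum of
    the masses of its open neighbourhoods. The space need not be locally compact.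
    Instead, a function bounded by [1] that vanishes where [rho <= r] has norm at
    most [1 / r]; so [ell] is tight, and Dini's theorem on the compact sets
    [rho <= r] gives countable subadditivity ([open_mass_sigma_subadditive]).
    Caratheodory's theorem then provides a Borel measure, tightness makes it Radon
    ([riesz_mu_radon]), and slicing functions into layers shows that [rho] is
    integrable ([riesz_rho_lty]) and that integration recovers [ell]. *)

(** * Compactness *)

(** To prove [Q K] for a compact [K] it is enough that [Q] be inherited by
    subsets and finite unions and hold near each point of [K]: otherwise the
    sets whose complement in [K] satisfies [Q] form a proper filter on [K]
    without cluster point. *)
Lemma compact_ind (T : topologicalType) (K : set T) (Q : set T -> Prop) :
  compact K -> Q set0 ->
  (forall A B, Q A -> Q B -> Q (A `|` B)) ->
  (forall A B, A `<=` B -> Q B -> Q A) ->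
  (forall x, K x -> exists2 N, nbhs x N & Q N) -> Q K.
Proof.
move=> cK Q0 QU QS Qloc; apply: contrapT => nQK.
pose F : set_system T := [set A | Q (K `\` A)].
have FF : ProperFilter F.
  split; first by rewrite /F /= setD0.
  split.
  - by rewrite /F /= setDT.
  - by move=> A B FA FB; rewrite /F /= setDIr; exact: QU.
  - by move=> A B AB; apply: QS => x [Kx nBx]; split => // /AB.
have FK : F K by rewrite /F /= setDv.
have [x [Kx clx]] := cK F FF FK.
have [N xN QN] := Qloc _ Kx.
have FN : F (~` N) by apply: QS QN => y [_ /contrapT].
by have [y []] := clx _ _ FN xN.
Qed.

(** * Weighted function spaces *)

Section weighted_norm.
Context {R : realType} {X : topologicalType} (rho : X -> R).
Hypothesis rho_gt0 : forall x, 0 < rho x.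
Implicit Types (f g : X -> R) (c : R).

Lemma le_wnorm f x : Brho rho f -> `|f x| <= wnorm rho f * rho x.
Proof.
move=> Bf; rewrite -ler_pdivrMr// mulrC.
by apply: ub_le_sup => //; exists x.
Qed.

Lemma Brho_le f c : (forall x, `|f x| <= c * rho x) -> Brho rho f.
Proof. by move=> fc; exists c => _ [x _ <-]; rewrite mulrC ler_pdivrMr. Qed.

Lemma wnorm_le f c : 0 <= c -> (forall x, `|f x| <= c * rho x) ->
  wnorm rho f <= c.
Proof.
move=> c0 fc; rewrite /wnorm.
have [->|/set0P ne] := eqVneq (weighted_range rho f) set0.
  by rewrite sup0.
by apply: ge_sup => // _ [x _ <-]; rewrite mulrC ler_pdivrMr.
Qed.

Lemma wnorm_ge0 f : 0 <= wnorm rho f.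
Proof.
rewrite /wnorm.
have [[[r Br] ub]|/sup_out ->//] := pselect (has_sup (weighted_range rho f)).
rewrite (le_trans _ (ub_le_sup ub Br))//.
by case: Br => x _ <-; rewrite mulr_ge0// invr_ge0 ltW.
Qed.

End weighted_norm.

Section weighted_space_theory.
Context {R : realType} {X : topologicalType} (rho : X -> R).
Hypothesis wX : weighted_space rho.
Implicit Types (f g : X -> R) (c e r : R).

Let rho_gt0 := weight_gt0 wX.

Lemma closed_sublevel r : closed [set x | rho x <= r].
Proof.
have [r0|r0] := ltP 0 r.
  exact: compact_closed (weighted_hausdorff wX) (weight_compact wX r0).
rewrite (_ : [set _ | _] = set0); first exact: closed0.
apply/seteqP; split => // x /= xr.
by have := rho_gt0 x; rewrite ltNge (le_trans xr).
Qed.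

Lemma open_superlevel r : open [set x | r < rho x].
Proof.
rewrite (_ : [set _ | _] = ~` [set x | rho x <= r]); last first.
  by apply/seteqP; split => x /=;
    [rewrite ltNge => /negP|move/negP; rewrite -ltNge].
by apply: closed_openC; exact: closed_sublevel.
Qed.

(** The weight has open superlevel sets, hence is locally bounded away from
    zero, and this is uniform on the compact set where it is at most [1]. *)
Lemma weight_lbound : exists2 c, 0 < c & forall x, c <= rho x.
Proof.
have : exists2 c, 0 < c & forall x, rho x <= 1 -> c <= rho x.
  apply: (@compact_ind _ _
    (fun A => exists2 c, 0 < c & forall x, A x -> c <= rho x)
    (weight_compact wX ltr01)).
  - by exists 1.
  - move=> A B [a a0 Aa] [b b0 Bb]; exists (Num.min a b) => [|x].
      by rewrite lt_min a0.
    by case=> [/Aa|/Bb]; rewrite ge_min => ->; rewrite ?orbT.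
  - by move=> A B AB [b b0 Bb]; exists b => // x /AB/Bb.
  - move=> x _; exists [set y | rho x / 2 < rho y].
      apply: open_nbhs_nbhs; split; first exact: open_superlevel.
      by rewrite /= ltr_pdivrMr// ltr_pMr// ltr1n.
    by exists (rho x / 2) => [|y /= /ltW//]; rewrite divr_gt0.
move=> [c c0 cK]; exists (Num.min c 1) => [|x]; first by rewrite lt_min c0/=.
by rewrite ge_min; have [/cK ->//|/ltW ->] := leP (rho x) 1; rewrite orbT.
Qed.

Lemma CbP f : Cb f <-> continuous f /\ exists M, forall x, `|f x| <= M.
Proof.
rewrite /Cb/=; split=> -[cf bf]; split=> //.
  have [M [_ fM]] := bf; exists (M + 1) => x; apply: (fM (M + 1)) => //.
  by rewrite ltrDl.
case: bf => M fM; exists M; split; first exact: num_real.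
by move=> y My x _; exact: le_trans (fM x) (ltW My).
Qed.

Lemma Cb_lin a f g : Cb f -> Cb g -> Cb (fun x => a * f x + g x).
Proof.
move=> /CbP[cf [M fM]] /CbP[cg [N gN]]; apply/CbP; split.
  by move=> x; apply: cvgD; [apply: cvgMl_tmp; exact: cf|exact: cg].
exists (`|a| * M + N) => x; rewrite (le_trans (ler_normD _ _))// normrM.
by rewrite lerD// ler_wpM2l.
Qed.

Lemma Cb_cst c : Cb (fun _ : X => c).
Proof. by apply/CbP; split; [move=> x; exact: cvg_cst|exists `|c|]. Qed.

Lemma CbZ a f : Cb f -> Cb (fun x => a * f x).
Proof.
move=> Cf; rewrite (_ : (fun _ => _) = (fun x => a * f x + 0)).
  exact: Cb_lin (Cb_cst 0).
by apply/funext => x; rewrite addr0.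
Qed.

(** Pointwise form of membership in [calB]; no condition on the norm of the
    approximants is left, as the lower bound on the weight puts bounded functions
    in [Brho]. *)
Lemma calBP f : calB rho f <->
  forall e, 0 < e -> exists2 g, Cb g & forall x, `|f x - g x| <= e * rho x.
Proof.
have [c c0 cr] := weight_lbound.
have CbB g : Cb g -> Brho rho g.
  move=> /CbP[_ [M gM]]; apply: (@Brho_le _ _ _ rho_gt0 _ (`|M| / c)) => x.
  rewrite (le_trans (gM x))// mulrAC ler_pdivlMr//.
  by rewrite (le_trans (ler_norm _))// normrM (gtr0_norm c0) ler_wpM2l.
have BB f1 f2 : Brho rho f1 -> Brho rho f2 -> Brho rho (f1 \- f2).
  move=> B1 B2.
  apply: (@Brho_le _ _ _ rho_gt0 _ (wnorm rho f1 + wnorm rho f2)) => x.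
  by rewrite (le_trans (ler_normB _ _))// mulrDl lerD// le_wnorm.
split=> [[Bf fe] e e0|fe].
  have [g [Cg Bg fge]] := fe _ e0; exists g => // x.
  by rewrite (le_trans (le_wnorm rho_gt0 x (BB _ _ Bf Bg)))// ler_wpM2r// ltW.
split.
  have [g Cg fg] := fe _ ltr01.
  apply: (@Brho_le _ _ _ rho_gt0 _ (1 + wnorm rho g)) => x.
  rewrite -(subrK (g x) (f x)) (le_trans (ler_normD _ _))// mulrDl lerD//.
  by rewrite le_wnorm//; exact: CbB.
move=> e e0; have [g Cg fg] := fe (e / 2) (divr_gt0 e0 (ltr0Sn _ 1)).
exists g; split => //; first exact: CbB.
rewrite (@le_lt_trans _ _ (e / 2))//; last first.
  by rewrite ltr_pdivrMr// ltr_pMr// ltr1n.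
by apply: wnorm_le => //; rewrite ltW// divr_gt0.
Qed.

Lemma Cb_calB f : Cb f -> calB rho f.
Proof.
move=> Cf; apply/calBP => e e0; exists f => // x.
by rewrite subrr normr0 mulr_ge0// ltW.
Qed.

Lemma calB_Brho f : calB rho f -> Brho rho f.
Proof. by case. Qed.

Lemma calB_closed f :
  (forall e, 0 < e ->
    exists2 g, calB rho g & forall x, `|f x - g x| <= e * rho x) ->
  calB rho f.
Proof.
move=> fe; apply/calBP => e e0; have e20 : 0 < e / 2 by rewrite divr_gt0.
have [g /calBP/(_ _ e20)[h Ch gh] fg] := fe _ e20; exists h => // x.
rewrite -(subrKA (g x)) (le_trans (ler_normD _ _))//.
by rewrite (splitr e) mulrDl lerD.
Qed.

Lemma calB_lin a f g : calB rho f -> calB rho g ->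
  calB rho (fun x => a * f x + g x).
Proof.
move=> /calBP Bf /calBP Bg; apply/calBP => e e0.
have a0 : 0 < `|a| + 1 by rewrite ltr_wpDl.
have [f' Cf' ff'] :=
  Bf (e / (`|a| + 1) / 2) (divr_gt0 (divr_gt0 e0 a0) (ltr0Sn _ 1)).
have [g' Cg' gg'] := Bg (e / 2) (divr_gt0 e0 (ltr0Sn _ 1)).
exists (fun x => a * f' x + g' x) => [|x]; first exact: Cb_lin.
rewrite opprD addrACA -mulrBr (le_trans (ler_normD _ _))// (splitr e) mulrDl.
rewrite lerD// normrM (@le_trans _ _ ((`|a| + 1) * `|f x - f' x|))//.
  by rewrite ler_wpM2r// lerDl.
by rewrite mulrC -ler_pdivlMr// (le_trans (ff' x))// (mulrAC e) [leLHS]mulrAC.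
Qed.

End weighted_space_theory.

(** * Continuous functions subordinate to an open set *)

(** The functions between [0] and the indicator of [U]; vanishing outside [U] is
    asked instead of support in [U], as there need not be enough compactly
    supported functions. *)
Definition subordinate {R : realType} {X : topologicalType}
    (U : set X) (u : X -> R) :=
  [/\ continuous u, forall x, 0 <= u x <= 1 & forall x, ~ U x -> u x = 0].

Section subordinate_theory.
Context {R : realType} {X : topologicalType}.
Implicit Types (U V : set X) (u v f : X -> R).

Lemma subordinate_Cb U u : subordinate U u -> Cb u.
Proof.
move=> [cu u01 _]; apply/CbP; split => //; exists 1 => x.
by have /andP[u0 u1] := u01 x; rewrite ger0_norm.
Qed.

Lemma subordinateS U V u : U `<=` V -> subordinate U u -> subordinate V u.
Proof. by move=> UV [cu u01 u0]; split=> // x nVx; apply: u0 => /UV. Qed.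

Lemma subordinate0 U : subordinate U (fun=> 0 : R).
Proof. by split => // [x|x]; [exact: cvg_cst|rewrite lexx ler01]. Qed.

Lemma continuous_maxr u v : continuous u -> continuous v ->
  continuous (fun x => Num.max (u x) (v x)).
Proof.
by move=> cu cv x; apply: (@continuous_max R X u v x); [exact: cu|exact: cv].
Qed.

Lemma continuous_minr u v : continuous u -> continuous v ->
  continuous (fun x => Num.min (u x) (v x)).
Proof.
by move=> cu cv x; apply: (@continuous_min R X u v x); [exact: cu|exact: cv].
Qed.

Lemma subordinate_max U u v : subordinate U u -> subordinate U v ->
  subordinate U (fun x => Num.max (u x) (v x)).
Proof.
move=> [cu u01 uU] [cv v01 vU]; split.
- exact: continuous_maxr.
- move=> x; have /andP[u0 u1] := u01 x; have /andP[v0 v1] := v01 x.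
  by rewrite le_max u0 ge_max u1 v1.
- by move=> x nUx; rewrite uU// vU// maxxx.
Qed.

Lemma subordinate_cutoff U x : completely_regular_space X -> open U -> U x ->
  exists2 u : X -> R, subordinate U u & \forall y \near x, u y = 1.
Proof.
move=> crX oU Ux.
have /(@uniform_separatorP _ R)[f [cf f01 fx fU]] :=
  crX x (~` U) (open_closedC oU) (fun nUx => nUx Ux).
have {}fx : f x = 0 by apply: fx; exists x.
have {}fU y : ~ U y -> f y = 1 by move=> nUy; apply: fU; exists y.
have {}f01 y : 0 <= f y <= 1.
  by have := f01 (f y); rewrite /= in_itv/=; apply; exists y.
exists (fun y => Num.min 1 (2 * (1 - f y))).
  split.
  - apply: continuous_minr => y; first exact: cvg_cst.
    by apply: cvgMl_tmp; apply: cvgB; [exact: cvg_cst|exact: cf].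
  - move=> y; have /andP[f0 f1] := f01 y.
    by rewrite le_min ler01 ge_min lexx/= mulr_ge0// subr_ge0.
  - by move=> y /fU ->; rewrite subrr mulr0 min_r.
have : \forall y \near x, f y < 2^-1.
  by apply: (@cvgr_lt _ _ _ _ f (f x) (cf x)); rewrite fx invr_gt0.
by apply: filterS => y fy; rewrite min_l//; lra.
Qed.

(** A form of Dini's theorem, standing in for a partition of unity. The families
    [u] are directed under pointwise maximum, and by complete regularity some
    member reaches [1] near any given point of [K] where [f] is positive. *)
Lemma subordinate_cover (U : nat -> set X) f (K : set X) e :
  completely_regular_space X -> (forall n, open (U n)) -> compact K ->
  subordinate (\bigcup_n U n) f -> 0 < e ->
  exists n (u : nat -> X -> R), (forall i, subordinate (U i) (u i)) /\
    forall x, K x -> f x <= e + \sum_(i < n) u i x.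
Proof.
move=> crX oU cK [cf f01 fU] e0.
pose Q (A : set X) := exists n (u : nat -> X -> R),
  (forall i, subordinate (U i) (u i)) /\
  forall x, A x -> f x <= e + \sum_(i < n) u i x.
apply: (@compact_ind _ _ Q cK).
- by exists 0%N, (fun _ _ => 0); split => // i; exact: subordinate0.
- move=> A B [n [u [sU uA]]] [m [v [sV vB]]].
  exists (maxn n m), (fun i x => Num.max (u i x) (v i x)); split.
    by move=> i; exact: subordinate_max.
  have widen (k : nat) (w : nat -> X -> R) x : (k <= maxn n m)%N ->
      (forall i, 0 <= w i x <= Num.max (u i x) (v i x)) ->
      \sum_(i < k) w i x <= \sum_(i < maxn n m) Num.max (u i x) (v i x).
    move=> kmax w0.
    rewrite (big_ord_widen _ (fun i => w i x) kmax) big_mkcond/=.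
    apply: ler_sum => i _; have /andP[wi0 wi] := w0 i.
    by case: ifP => // _; exact: le_trans wi.
  move=> x [/uA|/vB] /le_trans; apply; rewrite lerD2l; apply: widen.
  + exact: leq_maxl.
  + by move=> i; have [_ /(_ x)/andP[-> _] _] := sU i; rewrite le_max lexx.
  + exact: leq_maxr.
  + by move=> i; have [_ /(_ x)/andP[-> _] _] := sV i; rewrite le_max lexx orbT.
- by move=> A B AB [n [u [sU uA]]]; exists n, u; split=> // x /AB/uA.
move=> x Kx; have [fx|fx] := ltP (f x) e.
  exists [set y | f y < e].
    by apply: (@cvgr_lt _ _ _ _ f (f x) (cf x)).
  exists 0%N, (fun _ _ => 0); split => [i|y /= /ltW fy].
    exact: subordinate0.
  by rewrite big_ord0 addr0.
have [k _ Ukx] : (\bigcup_n U n) x.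
  by apply: contrapT => /fU fx0; move: fx; rewrite fx0 leNgt e0.
have [u su u1] := subordinate_cutoff crX (oU k) Ukx.
exists [set y | u y = 1] => //.
exists k.+1, (fun i => if i == k then u else fun=> 0); split.
  by move=> i; case: eqP => [->//|_]; exact: subordinate0.
move=> y /= uy; rewrite (bigD1 (@ord_max k))//= eqxx uy.
rewrite big1 => [|i /negPf]; last by rewrite -val_eqE/= => ->.
by have /andP[_ fy1] := f01 y; rewrite addr0 (le_trans fy1)// lerDr ltW.
Qed.

End subordinate_theory.

(** * Counting layers *)

(** There are at most [t + 1] integers [k] below [t]. Weights are allowed so that
    this covers functions subordinate to superlevel sets besides indicators. *)
Lemma sum_superlevel_le (R : realType) (a : nat -> R) (t : R) n : (0 <= t)%R ->
  (forall k, a k <= 1)%R -> (forall k, (t <= k%:R)%R -> a k = 0)%R ->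
  (\sum_(k < n) a k <= t + 1)%R.
Proof.
move=> t0 a1 a0; elim: n => [|n ih]; first by rewrite big_ord0 addr_ge0.
have [tn|nt] := leP t n%:R; first by rewrite big_ord_recr/= a0// addr0.
rewrite (@le_trans _ _ (\sum_(k < n.+1) 1)%R)//; first exact: ler_sum.
by rewrite sumr_const card_ord -natr1 lerD2r ltW.
Qed.

Lemma sum_layers (R : realType) (t : R) n : (0 <= t)%R ->
  (\sum_(k < n) Num.min 1 (Num.max 0 (t - k%:R)) = Num.min t n%:R)%R.
Proof.
move=> t0; elim: n => [|n ih]; first by rewrite big_ord0 min_r.
rewrite big_ord_recr/= ih -natr1.
have [tn|nt] := leP t n%:R.
  by rewrite max_l ?subr_le0// (min_r ler01) addr0 min_l//; lra.
rewrite (max_r (_ : 0 <= t - n%:R)%R); last by rewrite subr_ge0 ltW.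
have [tn1|n1t] := leP t (n%:R + 1)%R.
  by rewrite min_r; lra.
by rewrite min_l; lra.
Qed.

(** * Outer measure of a positive functional *)

Section riesz_representation.
Context {R : realType} {X : ptopologicalType} (rho : X -> R).
Variables (ell : (X -> R) -> R) (M : R).
Hypothesis wX : weighted_space rho.
Hypothesis M_ge0 : 0 <= M.
Hypothesis ell_lin : forall a f g, calB rho f -> calB rho g ->
  ell (fun x => a * f x + g x) = a * ell f + ell g.
Hypothesis ell_ge0 : forall f, calB rho f -> (forall x, 0 <= f x) -> 0 <= ell f.
Hypothesis ell_bound : forall f c, calB rho f -> 0 <= c ->
  (forall x, `|f x| <= c * rho x) -> `|ell f| <= M * c.
Implicit Types (f g u v : X -> R) (U V A : set X).

Let rho_gt0 := weight_gt0 wX.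
Let crX := weighted_completely_regular wX.
Let CbB := Cb_calB wX.
Let subB U u (sU : subordinate U u) := CbB (subordinate_Cb sU).

Let calB0 : calB rho (fun=> 0).
Proof. exact: CbB (Cb_cst 0). Qed.

Let ell0 : ell (fun=> 0) = 0.
Proof.
have := ell_lin (-1) calB0 calB0.
by rewrite mulr0 addr0 mulN1r addNr => ->.
Qed.

Let ellZ a f : calB rho f -> ell (fun x => a * f x) = a * ell f.
Proof.
move=> Bf; have := ell_lin a Bf calB0; rewrite ell0 addr0 => <-.
by congr ell; apply/funext => x; rewrite addr0.
Qed.

Let ellD f g : calB rho f -> calB rho g ->
  ell (fun x => f x + g x) = ell f + ell g.
Proof.
move=> Bf Bg; have := ell_lin 1 Bf Bg; rewrite mul1r => <-.
by congr ell; apply/funext => x; rewrite mul1r.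
Qed.

Let ellB f g : calB rho f -> calB rho g ->
  ell (fun x => f x - g x) = ell f - ell g.
Proof.
move=> Bf Bg; have := ell_lin (-1) Bg Bf; rewrite mulN1r addrC => <-.
by congr ell; apply/funext => x; rewrite mulN1r addrC.
Qed.

Let calBB f g : calB rho f -> calB rho g -> calB rho (fun x => f x - g x).
Proof.
move=> Bf Bg; rewrite (_ : (fun _ => _) = (fun x => (-1) * g x + f x)).
  exact: calB_lin.
by apply/funext => x; rewrite mulN1r addrC.
Qed.

Let calBD f g : calB rho f -> calB rho g -> calB rho (fun x => f x + g x).
Proof.
move=> Bf Bg; rewrite (_ : (fun _ => _) = (fun x => 1 * f x + g x)).
  exact: calB_lin.
by apply/funext => x; rewrite mul1r.
Qed.

Let ell_le f g : calB rho f -> calB rho g -> (forall x, f x <= g x) ->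
  ell f <= ell g.
Proof.
move=> Bf Bg fg; rewrite -subr_ge0 -ellB//; apply: ell_ge0; first exact: calBB.
by move=> x; rewrite subr_ge0.
Qed.

Let calB_sum n (u : nat -> X -> R) : (forall i, calB rho (u i)) ->
  calB rho (fun x => \sum_(i < n) u i x).
Proof.
move=> Bu; elim: n => [|n ih].
  by rewrite (_ : (fun _ => _) = fun=> 0)//; apply/funext => x; rewrite big_ord0.
rewrite (_ : (fun _ => _) = fun x => \sum_(i < n) u i x + u n x).
  exact: calBD.
by apply/funext => x; rewrite big_ord_recr.
Qed.

Let ell_sum n (u : nat -> X -> R) : (forall i, calB rho (u i)) ->
  ell (fun x => \sum_(i < n) u i x) = \sum_(i < n) ell (u i).
Proof.
move=> Bu; elim: n => [|n ih].
  by rewrite big_ord0 -[RHS]ell0; congr ell; apply/funext => x; rewrite big_ord0.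
rewrite big_ord_recr/= -ih -ellD//; last exact: calB_sum.
by congr ell; apply/funext => x; rewrite big_ord_recr.
Qed.

Local Open Scope ereal_scope.

Definition open_mass U : \bar R :=
  ereal_sup [set (ell u)%:E | u in subordinate U].

Lemma le_open_mass U u : subordinate U u -> (ell u)%:E <= open_mass U.
Proof. by move=> sU; apply: ereal_sup_ubound; exists u. Qed.

Lemma open_mass_le U c : (forall u, subordinate U u -> (ell u)%:E <= c) ->
  open_mass U <= c.
Proof. by move=> h; apply: ge_ereal_sup => _ [u sU <-]; exact: h. Qed.

Lemma open_massS U V : U `<=` V -> open_mass U <= open_mass V.
Proof.
by move=> UV; apply: open_mass_le => u /(subordinateS UV); exact: le_open_mass.
Qed.

Lemma open_mass_ge0 U : 0 <= open_mass U.
Proof. by have := le_open_mass (subordinate0 U); rewrite ell0. Qed.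

Lemma open_mass0 : open_mass set0 = 0.
Proof.
apply/eqP; rewrite eq_le open_mass_ge0 andbT; apply: open_mass_le => u [_ _ u0].
by rewrite (_ : u = fun=> 0%R) ?ell0//; apply/funext => x; exact: u0.
Qed.

Lemma subordinateT : subordinate setT (fun _ : X => 1%R : R).
Proof. by split => x; [exact: cvg_cst|rewrite lexx ler01|move=> /(_ I)]. Qed.

Lemma open_mass_fin U : open_mass U \is a fin_num.
Proof.
rewrite ge0_fin_numE ?open_mass_ge0// (@le_lt_trans _ _ (ell (fun=> 1%R))%:E)//.
  apply: open_mass_le => u sU; rewrite lee_fin; apply: ell_le.
  - exact: subB sU.
  - exact: subB subordinateT.
  - by case: sU => _ u01 _ x; have /andP[] := u01 x.
exact: ltry.
Qed.

Lemma open_massT : open_mass setT = (ell (fun=> 1%R))%:E.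
Proof.
apply/eqP; rewrite eq_le le_open_mass ?andbT; last exact: subordinateT.
apply: open_mass_le => u sU; rewrite lee_fin; apply: ell_le.
- exact: subB sU.
- exact: subB subordinateT.
- by case: sU => _ u01 _ x; have /andP[] := u01 x.
Qed.

(** Where Dini's theorem replaces local compactness: on [rho <= 1 / d] finitely
    many [u i] cover [f] up to a small error, and outside that set any function
    bounded by [1] is at most [d * rho], which [ell] sends below [M * d]. *)
Lemma open_mass_sigma_subadditive (U : nat -> set X) : (forall n, open (U n)) ->
  open_mass (\bigcup_n U n) <= \sum_(n <oo) open_mass (U n).
Proof.
move=> oU; apply: open_mass_le => f sf.
apply/lee_addgt0Pr => e e0.
have [c c0 cr] := weight_lbound wX.
have M1 : (0 < M + 1)%R by rewrite ltr_wpDl.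
pose d := (e / (M + 1))%R; have d0 : (0 < d)%R by rewrite divr_gt0.
have Kc : compact [set x | (rho x <= d^-1)%R].
  by apply: (weight_compact wX); rewrite invr_gt0.
have [n [u [su fu]]] := subordinate_cover crX oU Kc sf (mulr_gt0 d0 c0).
(* the part of f that the finite sum fails to cover *)
pose r x := Num.max 0%R (f x - \sum_(i < n) u i x)%R.
have Bu i : calB rho (u i) by exact: subB (su i).
have f01 x : (0 <= f x <= 1)%R by case: sf.
have u0 x : (0 <= \sum_(i < n) u i x)%R.
  by apply: sumr_ge0 => i _; have [_ /(_ x)/andP[]] := su i.
have cs m : continuous (fun x => \sum_(i < m) u i x)%R.
  elim: m => [|m ih].
    rewrite (_ : (fun _ => _) = fun=> 0%R); first by move=> x; exact: cvg_cst.
    by apply/funext => x; rewrite big_ord0.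
  rewrite (_ : (fun _ => _) = fun x => (\sum_(i < m) u i x + u m x)%R).
    by move=> x; apply: cvgD; [exact: ih|case: (su m) => cu _ _; exact: cu].
  by apply/funext => x; rewrite big_ord_recr.
have r0 x : (0 <= r x)%R by rewrite le_max lexx.
have Br : calB rho r.
  apply: CbB; apply/CbP; split.
    apply: continuous_maxr => x; first exact: cvg_cst.
    apply: cvgB; first by case: sf => cf _ _; exact: cf.
    exact: cs.
  exists 1%R => x; rewrite ger0_norm// ge_max ler01/=.
  by have /andP[_ f1] := f01 x; rewrite lerBlDr (le_trans f1)// lerDl.
have rd x : (`|r x| <= d * rho x)%R.
  rewrite ger0_norm// ge_max mulr_ge0 ?(ltW (rho_gt0 _)) ?(ltW d0)//=.
  have [Kx|nKx] := leP (rho x) (d^-1)%R.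
    rewrite lerBlDr (le_trans (fu _ Kx))// lerD2r ler_pM2l//; exact: cr.
  have /andP[_ f1] := f01 x.
  rewrite lerBlDr (le_trans f1)// (@le_trans _ _ (d * rho x)%R)// ?lerDl//.
  by rewrite -ler_pdivrMl// mulr1 ltW.
have Bs : calB rho (fun x => \sum_(i < n) u i x)%R by exact: calB_sum.
have fle : (ell f <= ell r + \sum_(i < n) ell (u i))%R.
  rewrite -ell_sum// -ellD//; apply: ell_le => //.
  - exact: subB sf.
  - exact: calBD.
  - by move=> x; rewrite -lerBlDr le_max lexx orbT.
have re : (ell r <= e)%R.
  rewrite (le_trans (ler_norm _))// (le_trans (ell_bound Br (ltW d0) rd))//.
  by rewrite /d mulrCA -{2}[e]mulr1 ler_pM2l// ler_pdivrMr// mul1r lerDl.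
apply: (@le_trans _ _ (\sum_(i < n) open_mass (U i) + e%:E)).
  apply: (@le_trans _ _ (\sum_(i < n) (ell (u i))%:E + e%:E)).
    by rewrite sumEFin -EFinD lee_fin (le_trans fle)// addrC lerD2l.
  by apply: leeD2r; apply: lee_sum => i _; exact: le_open_mass.
apply: leeD2r; rewrite -(big_mkord xpredT (fun i => open_mass (U i))).
by apply: nneseries_lim_ge => i _ _; exact: open_mass_ge0.
Qed.

Definition riesz_ext A : \bar R :=
  ereal_inf [set open_mass U | U in [set U | open U /\ A `<=` U]].

Lemma riesz_ext_le A U : open U -> A `<=` U -> riesz_ext A <= open_mass U.
Proof. by move=> oU AU; apply: ereal_inf_lbound; exists U. Qed.

Lemma riesz_ext_open U : open U -> riesz_ext U = open_mass U.
Proof.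
move=> oU; apply/eqP; rewrite eq_le riesz_ext_le//=.
by apply: le_ereal_inf_tmp => _ [V [_ UV] <-]; exact: open_massS.
Qed.

Lemma riesz_ext_ge0 A : 0 <= riesz_ext A.
Proof. by apply: le_ereal_inf_tmp => _ [V _ <-]; exact: open_mass_ge0. Qed.

Lemma riesz_ext0 : riesz_ext set0 = 0.
Proof. by rewrite riesz_ext_open ?open_mass0//; exact: open0. Qed.

Lemma riesz_extS A B : A `<=` B -> riesz_ext A <= riesz_ext B.
Proof.
move=> AB; apply: le_ereal_inf_tmp => _ [V [oV BV] <-].
by apply: riesz_ext_le => // x /AB/BV.
Qed.

Lemma riesz_ext_fin A : riesz_ext A \is a fin_num.
Proof.
rewrite ge0_fin_numE ?riesz_ext_ge0//.
rewrite (@le_lt_trans _ _ (open_mass setT))//.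
  by apply: riesz_ext_le => //; exact: openT.
by rewrite -ge0_fin_numE ?open_mass_ge0// open_mass_fin.
Qed.

Lemma riesz_ext_approx A e : (0 < e)%R ->
  exists U, [/\ open U, A `<=` U & open_mass U <= riesz_ext A + e%:E].
Proof.
move=> e0; have [_ [U [oU AU] <-] Ue] :=
  lb_ereal_inf_adherent e0 (riesz_ext_fin A).
by exists U; split => //; exact: ltW.
Qed.

Lemma riesz_ext_sigma_subadditive : sigma_subadditive riesz_ext.
Proof.
move=> A; apply/lee_addgt0Pr => e e0.
have /choice[U UP] : forall n, exists U, [/\ open U, A n `<=` U &
    open_mass U <= riesz_ext (A n) + (e / (2 ^ n.+1)%:R)%:E].
  by move=> n; apply: riesz_ext_approx; rewrite divr_gt0// ltr0n expn_gt0.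
apply: (@le_trans _ _ (open_mass (\bigcup_n U n))).
  apply: riesz_ext_le; first by apply: bigcup_open => n _; case: (UP n).
  by apply: subset_bigcup => n _; case: (UP n).
apply: (@le_trans _ _ (\sum_(n <oo) open_mass (U n))).
  by apply: open_mass_sigma_subadditive => n; case: (UP n).
apply: le_trans (epsilon_trick xpredT _ (ltW e0)).
  apply: lee_nneseries => n *; first exact: open_mass_ge0.
  by case: (UP n).
by move=> n; exact: riesz_ext_ge0.
Qed.

Definition riesz_outer : {outer_measure set X -> \bar R} :=
  HB.pack riesz_ext (isOuterMeasure.Build R X riesz_ext riesz_ext0
    riesz_ext_ge0 riesz_extS riesz_ext_sigma_subadditive).

(** Given [f] subordinate to [V `&` U], lowering [f] by [d] to [g] leaves the open
    set [W], on which [g] vanishes, free to receive another function [h]; then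
    [g + h] is still subordinate to [V], and [W] covers [V `&` ~` U]. *)
Lemma open_caratheodory U : open U -> riesz_outer.-caratheodory U.
Proof.
move=> oU; apply: le_caratheodory_measurable => A /=.
apply: le_ereal_inf_tmp => _ [V [oV AV] <-].
apply: (@le_trans _ _ (open_mass (V `&` U) + riesz_ext (V `&` ~` U))).
  apply: leeD; last by apply: riesz_extS; exact: setSI.
  by apply: riesz_ext_le; [exact: openI|exact: setSI].
rewrite -leeBrDr ?riesz_ext_fin//; apply: open_mass_le => f sf.
rewrite leeBrDr ?riesz_ext_fin//; apply/lee_addgt0Pr => e e0.
have [cf f01 f0] := sf.
pose c := ell (fun=> 1%R).
have c0 : (0 <= c)%R by apply: ell_ge0 => //; exact: subB subordinateT.
have c1 : (0 < c + 1)%R by rewrite ltr_wpDl.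
pose d := (e / (c + 1))%R; have d0 : (0 < d)%R by rewrite divr_gt0.
pose W := V `&` [set x | (f x < d)%R].
have oW : open W.
  apply: openI => //; rewrite (_ : [set _ | _] = f @^-1` [set y | (y < d)%R])//.
  by apply: open_comp; [move=> x _; exact: cf|exact: open_lt].
have WVU : V `&` ~` U `<=` W.
  by move=> x [Vx nUx]; split => //=; rewrite f0// => -[].
pose g x := Num.max 0%R (f x - d)%R.
have sg : subordinate V g.
  split.
  - apply: continuous_maxr => x; first exact: cvg_cst.
    by apply: cvgB; [exact: cf|exact: cvg_cst].
  - move=> x; have /andP[_ f1] := f01 x.
    by rewrite le_max lexx/= ge_max ler01/= lerBlDr (le_trans f1)// lerDl ltW.
  - move=> x nVx; rewrite /g f0 => [|[]//].
    by rewrite max_l// sub0r oppr_le0 ltW.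
apply: (@le_trans _ _ ((ell g + e)%:E + open_mass W)).
  apply: leeD; last exact: riesz_ext_le.
  rewrite lee_fin; have B1 := subB subordinateT; have Bg := subB sg.
  apply: (@le_trans _ _ (ell (fun x => d * 1 + g x))%R).
    apply: ell_le; [exact: subB sf|exact: calB_lin|] => x.
    by rewrite mulr1 -lerBlDl le_max lexx orbT.
  rewrite ell_lin// addrC lerD2l -/c /d -mulrA -{2}[e]mulr1 ler_pM2l//.
  by rewrite mulrC ler_pdivrMr// mul1r lerDl.
rewrite EFinD addeAC leeD2r// -leeBrDl//; apply: open_mass_le => h sh.
rewrite leeBrDl// -EFinD -ellD; [|exact: subB sg|exact: subB sh].
apply: le_open_mass; have [cg g01 g0] := sg; have [ch h01 h0] := sh; split.
- by move=> x; apply: cvgD; [exact: cg|exact: ch].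
- move=> x; have /andP[gx0 gx1] := g01 x; have /andP[hx0 hx1] := h01 x.
  rewrite addr_ge0//=; have [fxd|fxd] := ltP (f x) d.
    by rewrite /g max_l ?add0r// subr_le0 ltW.
  by rewrite h0 ?addr0// => -[_ /=]; rewrite ltNge fxd.
- by move=> x nVx; rewrite g0// h0 ?addr0// => -[].
Qed.


(** * The representing Radon measure *)

Let sigma_algebra_cara : sigma_algebra [set: X] riesz_outer.-cara.-measurable.
Proof.
split; first exact: measurable0.
- by move=> A mA; rewrite setTD; exact: measurableC.
- by move=> F mF; exact: bigcupT_measurable.
Qed.

Lemma borel_caratheodory (A : set (borel X)) :
  measurable A -> riesz_outer.-caratheodory A.
Proof.
apply: smallest_sub; first exact: sigma_algebra_cara.
by move=> U; exact: open_caratheodory.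
Qed.

Let riesz_measure_sigma_additive :
  semi_sigma_additive (riesz_ext : set (borel X) -> \bar R).
Proof.
move=> F mF tF mUF.
apply: (@caratheodory_measure_sigma_additive R X riesz_outer) => //.
- by move=> i; exact: borel_caratheodory.
- exact: borel_caratheodory.
Qed.

Definition riesz_mu : {measure set (borel X) -> \bar R} :=
  HB.pack (riesz_ext : set (borel X) -> \bar R)
    (isMeasure.Build _ _ _ (riesz_ext : set (borel X) -> \bar R)
      riesz_ext0 riesz_ext_ge0 riesz_measure_sigma_additive).

Lemma open_borel (U : set X) : open U -> measurable (U : set (borel X)).
Proof. exact: sub_sigma_algebra. Qed.

Lemma lsc_measurable (f : X -> R) : (forall r, open [set x | r < f x]%R) ->
  measurable_fun setT (f : borel X -> R).
Proof.
move=> lf; apply: (measurability _ (RGenOInfty.measurableE R)).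
move=> _ [_ [r ->] <-]; rewrite setTI; apply: open_borel.
by rewrite (_ : _ @^-1` _ = [set x | r < f x]%R)//; apply/seteqP; split => x /=;
  rewrite in_itv/= andbT.
Qed.

Lemma continuous_borel (f : X -> R) : continuous f ->
  measurable_fun setT (f : borel X -> R).
Proof.
move=> cf; apply: lsc_measurable => r.
rewrite (_ : [set _ | _] = f @^-1` [set y | r < y]%R)//.
by apply: open_comp; [move=> x _; exact: cf|exact: open_gt].
Qed.

Let rho_measurable : measurable_fun setT (rho : borel X -> R).
Proof. by apply: lsc_measurable => r; exact: open_superlevel. Qed.

(** Tightness: a function vanishing where [rho <= r] and bounded by [1] is at most
    [rho / r]. *)
Lemma riesz_tail r : (0 < r)%R ->
  open_mass [set x | (r < rho x)%R] <= (M / r)%:E.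
Proof.
move=> r0; apply: open_mass_le => u su; rewrite lee_fin (le_trans (ler_norm _))//.
apply: ell_bound; [exact: subB su|by rewrite invr_ge0 ltW|move=> x].
have [_ /(_ x)/andP[ux0 ux1] u0] := su; rewrite ger0_norm//.
have [xr|xr] := ltP r (rho x); last first.
  by rewrite u0 ?mulr_ge0 ?invr_ge0 ?ltW//=; apply/negP; rewrite -leNgt.
by rewrite (le_trans ux1)// mulrC ler_pdivlMr// mul1r ltW.
Qed.

(** Outer regularity holds by construction; applied to the complement of [A] it
    gives a closed subset of [A] of almost full measure, which tightness cuts
    down to a compact one. *)
Lemma riesz_mu_radon : finite_radon riesz_mu.
Proof.
split; first by rewrite -ge0_fin_numE//; exact: riesz_ext_fin.
move=> A mA; apply/eqP; rewrite eq_le; apply/andP; split; last first.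
  by apply: ge_ereal_sup => _ [K [_ KA] <-]; exact: riesz_extS.
apply/lee_addgt0Pr => e e0; have e20 : (0 < e / 2)%R by rewrite divr_gt0.
have [U [oU AU Ue]] := riesz_ext_approx (~` A) e20.
have M1 : (0 < M + 1)%R by rewrite ltr_wpDl.
pose r := ((M + 1) / (e / 2))%R; have r0 : (0 < r)%R by rewrite divr_gt0.
pose K := [set x | (rho x <= r)%R] `&` ~` U.
have cK : compact K.
  by apply: compact_closedI; [exact: (weight_compact wX)|exact: open_closedC].
have KA : K `<=` A by move=> x [_ nUx]; apply: contrapT => /AU.
have AUe : riesz_ext (U `&` A) <= (e / 2)%:E.
  have := borel_caratheodory mA U; rewrite /= => UE.
  have : riesz_ext (~` A) <= riesz_ext (U `&` ~` A).
    by apply: riesz_extS => x nAx; split=> //; exact: AU.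
  move=> /(leeD2l (riesz_ext (U `&` A))).
  rewrite -UE (riesz_ext_open oU) => /le_trans/(_ Ue).
  by rewrite addeC leeD2lE ?riesz_ext_fin.
apply: (@le_trans _ _ (riesz_ext K + e%:E)); last first.
  by apply: leeD2r; apply: ereal_sup_ubound; exists K.
have AK : A `<=` K `|` ((U `&` A) `|` [set x | (r < rho x)%R]).
  move=> x Ax; have [Ux|nUx] := pselect (U x); first by right; left.
  by have [xr|xr] := leP (rho x) r; [left|right; right].
rewrite (le_trans (riesz_extS AK))//.
rewrite (le_trans (outer_measureU2 riesz_outer _ _))//.
apply: leeD2l; rewrite (le_trans (outer_measureU2 riesz_outer _ _))//.
rewrite (splitr e) EFinD.
apply: leeD => //; rewrite /= riesz_ext_open; last exact: open_superlevel.
rewrite (le_trans (riesz_tail r0))// lee_fin ler_pdivrMr// /r mulrC divfK ?lerDl//.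
by rewrite gt_eqF.
Qed.

Let super k := [set x | (k%:R < rho x)%R].

(** Near-optimal functions for the sets [super k] add up to at most [rho + 1],
    which is at most [(1 + c^-1) * rho]. *)
Let sum_super_le c n : (0 < c)%R -> (forall x, c <= rho x)%R ->
  \sum_(k < n) riesz_ext (super k) <= (M * (1 + c^-1))%:E.
Proof.
move=> c0 cr; apply/lee_addgt0Pr => e e0.
pose e' := (e / n.+1%:R)%R; have e'0 : (0 < e')%R by rewrite divr_gt0.
have /choice[u uP] : forall k, exists u,
    subordinate (super k) u /\ riesz_ext (super k) <= (ell u + e')%:E.
  move=> k; have osk : open (super k) by exact: open_superlevel.
  have [_ [u su <-] ue] := ub_ereal_sup_adherent e'0 (open_mass_fin (super k)).
  exists u; split => //; rewrite riesz_ext_open// EFinD -leeBlDr//; exact: ltW.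
rewrite (@le_trans _ _ (\sum_(k < n) (ell (u k) + e')%:E))//.
  by apply: lee_sum => k _; case: (uP k).
rewrite sumEFin -EFinD lee_fin big_split/=; apply: lerD; last first.
  rewrite sumr_const card_ord -[leLHS]mulr_natr /e' mulrAC ler_pdivrMr//.
  by rewrite ler_pM2l// ler_nat.
rewrite -ell_sum; last by move=> k; case: (uP k) => /subB.
rewrite (le_trans (ler_norm _))//; apply: ell_bound.
- by apply: calB_sum => k; case: (uP k) => /subB.
- by rewrite addr_ge0// invr_ge0 ltW.
move=> x; have u01 k : (0 <= u k x <= 1)%R by case: (uP k) => -[_ + _] _; exact.
rewrite ger0_norm; last by apply: sumr_ge0 => k _; case/andP: (u01 k).
rewrite (@le_trans _ _ (rho x + 1)%R)//.
  apply: (@sum_superlevel_le R (fun k => u k x)) => [|k|k xk]; first exact: ltW.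
    by case/andP: (u01 k).
  by case: (uP k) => -[_ _ +] _; apply; rewrite /super/= ltNge xk.
by rewrite mulrDl mul1r lerD2l mulrC ler_pdivlMr// mul1r.
Qed.

(** Layer cake: [rho] is at most [1] plus the number of [k] with [k < rho]. *)
Lemma riesz_rho_lty : \int[riesz_mu]_y (rho y)%:E < +oo.
Proof.
have [c c0 cr] := weight_lbound wX.
have msuper k : measurable (super k : set (borel X)).
  by apply: open_borel; exact: open_superlevel.
have m1 k : measurable_fun setT (fun x : borel X => (\1_(super k) x : R)%:E).
  by apply/measurable_EFinP; exact: measurable_indic.
pose S (x : borel X) := \sum_(k <oo) (\1_(super k) x : R)%:E.
have S0 x : 0 <= S x by apply: nneseries_ge0 => k _ _; rewrite lee_fin.
have mS : measurable_fun setT S by apply: ge0_emeasurable_sum.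
apply: (@le_lt_trans _ _ (\int[riesz_mu]_y (S y + 1%:E))).
  apply: ge0_le_integral => //.
  - by move=> x _; rewrite lee_fin ltW.
  - by apply/measurable_EFinP; exact: rho_measurable.
  - exact: emeasurable_funD.
  move=> x _; pose n := Num.truncn (rho x).
  have /truncn_itv/andP[nrho rhon] := ltW (rho_gt0 x).
  rewrite (@le_trans _ _ (\sum_(k < n) (\1_(super k) x : R)%:E + 1%:E))//.
    rewrite sumEFin -EFinD lee_fin (eq_bigr (fun=> 1%R)) => [|k _].
      by rewrite sumr_const card_ord natr1 ltW.
    by rewrite indicE mem_set// /super/= (lt_le_trans _ nrho)// ltr_nat.
  apply: leeD2r; rewrite -(big_mkord xpredT (fun k => (\1_(super k) x : R)%:E)).
  by apply: nneseries_lim_ge => k _ _; rewrite lee_fin.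
rewrite ge0_integralD//=.
have i1 : \int[riesz_mu]_y 1%:E = riesz_mu setT.
  by have := integral_cst riesz_mu measurableT 1%:E; rewrite mul1e.
rewrite i1; apply: lte_add_pinfty; last by case: riesz_mu_radon.
have -> : \int[riesz_mu]_y S y =
    \sum_(k <oo) \int[riesz_mu]_y (\1_(super k) y : R)%:E.
  by apply: integral_nneseries.
apply: (@le_lt_trans _ _ (M * (1 + c^-1))%:E); last exact: ltry.
apply: lime_le; first by apply: is_cvg_nneseries => k _ _; exact: integral_ge0.
apply: nearW => n; rewrite big_mkord (le_trans _ (sum_super_le n c0 cr))//.
by apply: lee_sum => k _; rewrite integral_indic// setIT.
Qed.

Let rho_integrable : riesz_mu.-integrable setT (EFin \o (rho : borel X -> R)).
Proof.
apply/integrableP; split; first by apply/measurable_EFinP; exact: rho_measurable.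
rewrite (eq_integral (fun y : borel X => (rho y)%:E)).
  exact: riesz_rho_lty.
by move=> y _ /=; rewrite ger0_norm// ltW.
Qed.

Let weight_integrable c (f : borel X -> R) : measurable_fun setT f ->
  (forall x, `|f x| <= c * rho x)%R -> riesz_mu.-integrable setT (EFin \o f).
Proof.
move=> mf fc.
apply: (@le_integrable _ _ _ _ _ measurableT _
  (fun y : borel X => c%:E * (rho y)%:E)) => /=.
- exact/measurable_EFinP.
- by move=> x _; rewrite lee_fin (le_trans (fc x))// ler_norm.
- exact: (integrableZl measurableT c rho_integrable).
Qed.

Let Cb_integrable (f : X -> R) :
  Cb f -> riesz_mu.-integrable setT (EFin \o (f : borel X -> R)).
Proof.
move=> Cf; apply: (@weight_integrable (wnorm rho f)).
  by apply: continuous_borel; case: Cf.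
by move=> x; apply: le_wnorm => //; case: (CbB Cf).
Qed.

Local Notation I f := (\int[riesz_mu]_x f x)%R.

Let I1 : I (fun=> 1%R) = ell (fun=> 1%R).
Proof.
rewrite Rintegral_cst// mul1r /= riesz_ext_open; last exact: openT.
by rewrite open_massT.
Qed.

(** Cut [n * f] into [n] slices [g k] of height [1]. The slice [g k] is subordinate
    to [U k], so its value under [ell] is at most the measure of [U k], and these
    measures add up to at most the integral of [n * f + 1]. Dividing by [n] makes
    the error small. *)
Let ell_le_I (f : X -> R) : subordinate setT f -> (ell f <= I f)%R.
Proof.
move=> sf; have [cf f01 _] := sf; have B1 := subB subordinateT.
have c0 : (0 <= ell (fun=> 1))%R by exact: ell_ge0.
apply/ler_addgt0Pr => e e0.
pose n := (Num.truncn (ell (fun=> 1)%R / e)).+1.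
have n0 : (0 < n%:R :> R)%R by rewrite ltr0n.
have ne : (ell (fun=> 1) <= n%:R * e)%R.
  rewrite -ler_pdivrMr// ltW//.
  have : (0 <= ell (fun=> 1%R) / e)%R by rewrite divr_ge0// ltW.
  by move=> /truncn_itv/andP[].
pose g k x := Num.min 1%R (Num.max 0 (n%:R * f x - k%:R))%R.
pose U k := [set x | k%:R < n%:R * f x]%R.
have cnf k : continuous (fun x => n%:R * f x - k%:R)%R.
  by move=> x; apply: cvgB; [apply: cvgMl_tmp; exact: cf|exact: cvg_cst].
have oU k : open (U k).
  rewrite (_ : U k = (fun x => n%:R * f x - k%:R)%R @^-1` [set y | 0 < y]%R).
    by apply: open_comp; [move=> x _; exact: cnf|exact: open_gt].
  by apply/seteqP; split => x /=; rewrite /U/= subr_gt0.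
have sg k : subordinate (U k) (g k).
  split.
  - apply: continuous_minr => x; first exact: cvg_cst.
    by apply: continuous_maxr; [move=> ?; exact: cvg_cst|exact: cnf].
  - by move=> x; rewrite le_min ler01 le_max lexx ge_min lexx.
  - move=> x /negP; rewrite /U/= -leNgt => h.
    by rewrite /g max_l ?subr_le0// min_r.
have mU k : measurable (U k : set (borel X)) by exact: open_borel.
have m1 k : measurable_fun setT (fun x : borel X => (\1_(U k) x : R)%:E).
  by apply/measurable_EFinP; exact: measurable_indic.
have nf0 x : (0 <= n%:R * f x)%R by have /andP[? _] := f01 x; rewrite mulr_ge0.
have Cnf : Cb (fun x => n%:R * f x + 1)%R.
  by apply: Cb_lin; [exact: subordinate_Cb sf|exact: Cb_cst].
have key : ((n%:R * ell f)%:E <= \int[riesz_mu]_x (n%:R * f x + 1)%:E).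
  rewrite -ellZ; last exact: subB sf.
  have -> : ell (fun x => n%:R * f x)%R = (\sum_(k < n) ell (g k))%R.
    rewrite -ell_sum; last by move=> k; exact: subB (sg k).
    congr ell; apply/funext => x; rewrite sum_layers// min_l//.
    by have /andP[_ f1] := f01 x; rewrite -{2}[n%:R%R]mulr1 ler_wpM2l.
  rewrite -sumEFin (@le_trans _ _ (\sum_(k < n) riesz_ext (U k)))//.
    by apply: lee_sum => k _; rewrite riesz_ext_open//; exact: le_open_mass.
  have -> : \sum_(k < n) riesz_ext (U k) =
      \sum_(k < n) \int[riesz_mu]_x (\1_(U k) x : R)%:E.
    by apply: eq_bigr => k _; rewrite integral_indic// setIT.
  rewrite -ge0_integral_sum//.
  apply: ge0_le_integral => //.
  - by move=> x _; apply: sume_ge0 => k _; rewrite lee_fin.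
  - exact: emeasurable_sum.
  - by apply/measurable_EFinP; apply: continuous_borel; case: Cnf.
  move=> x _; rewrite sumEFin lee_fin.
  apply: (@sum_superlevel_le R (fun k => \1_(U k) x : R)) => //.
  by move=> k; rewrite indicE => h; rewrite memNset// /U/= ltNge h.
have iC := Cb_integrable Cnf.
have {key} : (n%:R * ell f <= I (fun x => n%:R * f x + 1))%R.
  by rewrite -lee_fin /Rintegral fineK//; exact: integrable_fin_num.
have If := Cb_integrable (subordinate_Cb sf).
rewrite RintegralD//; [|exact: Cb_integrable (CbZ _ (subordinate_Cb sf))
  |exact: Cb_integrable (Cb_cst 1)].
rewrite RintegralZl// I1 => h.
rewrite -(ler_pM2l n0) (le_trans h)// mulrDr lerD2l//.
Qed.

(** The reverse inequality is the same one for [1 - f]. *)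
Let ellE01 (f : X -> R) : subordinate setT f -> ell f = I f.
Proof.
move=> sf; apply/eqP; rewrite eq_le ell_le_I//=.
have sf' : subordinate setT (fun x => 1 - f x)%R.
  case: sf => cf f01 _; split => [x|x|x /(_ Logic.I)//].
    by apply: cvgB; [exact: cvg_cst|exact: cf].
  by have /andP[f0 f1] := f01 x; rewrite subr_ge0 f1/= gerBl.
have := ell_le_I sf'; rewrite ellB; [|exact: subB subordinateT|exact: subB sf].
rewrite RintegralB//; [|exact: Cb_integrable (Cb_cst 1)
  |exact: Cb_integrable (subordinate_Cb sf)].
by rewrite I1 lerD2l lerN2.
Qed.

Let ellE_Cb (f : X -> R) : Cb f -> ell f = I f.
Proof.
move=> Cf; have [cf [B' fB']] := (CbP f).1 Cf.
pose B := (`|B'| + 1)%R; have B0 : (0 < B)%R by rewrite ltr_wpDl.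
have fB x : (`|f x| <= B)%R.
  by rewrite (le_trans (fB' x))// (le_trans (ler_norm _))// lerDl.
pose h x := ((f x + B) / (2 * B))%R.
have sh : subordinate setT h.
  split => [x|x|x /(_ Logic.I)//].
    by apply: cvgMr_tmp; apply: cvgD; [exact: cf|exact: cvg_cst].
  have := fB x; rewrite ler_norml => /andP[f1 f2].
  rewrite divr_ge0 ?mulr_ge0 ?(ltW B0)//=; last lra.
  by rewrite ler_pdivrMr ?mulr_gt0//; lra.
have fE : f = (fun x => (2 * B) * h x + (- B))%R.
  apply/funext => x; rewrite /h mulrC divfK ?addrK//.
  by rewrite gt_eqF// mulr_gt0.
have Ch := subordinate_Cb sh.
have eB : ell (fun=> - B)%R = I (fun=> - B)%R.
  have -> : (fun _ : X => - B)%R = (fun=> - B * 1)%R.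
    by apply/funext => x; rewrite mulr1.
  rewrite ellZ; last exact: subB subordinateT.
  by rewrite RintegralZl// ?I1//; exact: Cb_integrable (Cb_cst 1).
rewrite fE ell_lin; [|exact: CbB|exact: CbB (Cb_cst _)].
rewrite RintegralD//; [|exact: Cb_integrable (CbZ _ Ch)
  |exact: Cb_integrable (Cb_cst _)].
rewrite RintegralZl ?eB ?ellE01//; exact: Cb_integrable.
Qed.

Lemma calB_measurable (f : X -> R) : calB rho f ->
  measurable_fun setT (f : borel X -> R).
Proof.
move=> /(calBP wX) Bf.
have /choice[g gP] : forall n : nat, exists g,
    Cb g /\ forall x, (`|f x - g x| <= n.+1%:R^-1 * rho x)%R.
  by move=> n; have [|g Cg fg] := Bf n.+1%:R^-1%R; [rewrite invr_gt0|exists g].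
apply: (@measurable_fun_cvg _ _ _ setT (fun n => g n : borel X -> R)).
  by move=> n; apply: continuous_borel; case: (gP n) => -[].
move=> x _; apply/cvgrPdist_le => e e0.
have er0 : (0 < e / rho x)%R by rewrite divr_gt0.
apply: filterS (near_infty_natSinv_lt (PosNum er0)) => n /= /ltW.
rewrite ler_pdivlMr// => ne.
by case: (gP n) => _ /(_ x) /le_trans; apply.
Qed.

Let calB_integrable (f : X -> R) : calB rho f ->
  riesz_mu.-integrable setT (EFin \o (f : borel X -> R)).
Proof.
move=> Bf; apply: (@weight_integrable (wnorm rho f)); first exact: calB_measurable.
by move=> x; apply: le_wnorm => //; case: Bf.
Qed.

(** Both sides are continuous for the weighted norm, the integral because [rho] is
    integrable, so the identity passes from [Cb] to its closure. *)
Let ellE (f : X -> R) : calB rho f -> ell f = I f.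
Proof.
move=> Bf; apply/eqP; rewrite -subr_eq0 -normr_le0; apply/ler_addgt0Pr => e e0.
have Ir0 : (0 <= I rho)%R by apply: Rintegral_ge0 => x _; rewrite ltW.
pose a := (M + I rho + 1)%R; have a0 : (0 < a)%R by rewrite ltr_wpDl// addr_ge0.
have d0 : (0 < e / a)%R by rewrite divr_gt0.
have [g Cg fg] := (calBP wX f).1 Bf _ d0.
have Bg := CbB Cg.
have -> : (ell f - I f = ell (fun x => f x - g x) - I (fun x => f x - g x))%R.
  rewrite ellB// RintegralB//; [|exact: calB_integrable|exact: calB_integrable].
  by rewrite -(ellE_Cb Cg) opprB addrA addrNK.
rewrite add0r (le_trans (ler_normB _ _))//.
have Bfg := calBB Bf Bg.
have h1 := ell_bound Bfg (ltW d0) fg.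
have h2 : (`|I (fun x => f x - g x)| <= e / a * I rho)%R.
  rewrite (le_trans (le_normr_Rintegral measurableT (calB_integrable Bfg)))//.
  rewrite -RintegralZl//; apply: le_Rintegral => //.
  - exact: integrable_norm (calB_integrable Bfg).
  - exact: (integrableZl measurableT _ rho_integrable).
rewrite (le_trans (lerD h1 h2))// (mulrC M) -mulrDr mulrAC ler_pdivrMr//.
by rewrite ler_pM2l// /a lerDl.
Qed.

Lemma riesz_measure_exists :
  exists mu : {measure set (borel X) -> \bar R}, riesz_measure rho ell mu.
Proof.
exists riesz_mu; split; [exact: riesz_mu_radon|exact: riesz_rho_lty|].
move=> f Bf; rewrite ellE// /Rintegral fineK//.
by apply: integrable_fin_num => //; exact: calB_integrable.
Qed.

End riesz_representation.

(** * Pulling functions back along q *)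

Lemma positive_op_riesz (R : realType) (X : ptopologicalType) (rho : X -> R)
    (T : (X -> R) -> (X -> R)) (x : X) :
  weighted_space rho -> bounded_linear_op rho T ->
  (forall f, calB rho f -> (forall y, 0 <= f y) -> forall y, 0 <= T f y) ->
  exists p : {measure set (borel X) -> \bar R},
    riesz_measure rho (fun f => T f x) p.
Proof.
move=> wX [TB Tlin [M TM]] T0; have rho_gt0 := weight_gt0 wX.
apply: (@riesz_measure_exists _ _ _ _ (`|M| * rho x)) => //.
- by rewrite mulr_ge0// ltW.
- by move=> a f g Bf Bg; rewrite Tlin.
- by move=> f Bf f0; exact: T0.
- move=> f c Bf c0 fc.
  rewrite (le_trans (le_wnorm rho_gt0 x (calB_Brho (TB _ Bf))))//.
  rewrite mulrAC ler_wpM2r//; first exact: ltW.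
  rewrite (le_trans (TM _ Bf))// (@le_trans _ _ (`|M| * wnorm rho f))//.
    by rewrite ler_wpM2r ?ler_norm// wnorm_ge0.
  by rewrite ler_wpM2l// wnorm_le.
Qed.

Lemma calB_comp (R : realType) (X Y : topologicalType) (rho1 : X -> R)
    (rho2 : Y -> R) (q : X -> Y) (f : Y -> R) :
  weighted_space rho1 -> weighted_space rho2 -> continuous q ->
  (forall x, rho2 (q x) <= rho1 x) -> calB rho2 f -> calB rho1 (f \o q).
Proof.
move=> wX wY cq rho_le /(calBP wY) Bf; apply/(calBP wX) => e e0.
have [g /CbP[cg [M gM]] fg] := Bf _ e0; exists (g \o q).
  apply/CbP; split; last by exists M => x; exact: gM.
  by move=> x; apply: continuous_comp; [exact: cq|exact: cg].
by move=> x; rewrite (le_trans (fg _))// ler_pM2l.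
Qed.

(** The bound on [rho2 \o q] upgrades the boundedness of [T], which only sees
    [rho1 x], to a bound by [rho2 (q x)]. *)
Lemma domination_pullback (R : realType) (X : ptopologicalType)
    (Y : topologicalType) (rho1 : X -> R) (rho2 : Y -> R) (q : X -> Y)
    (T : (X -> R) -> (X -> R)) (C : R) :
  weighted_space rho1 -> weighted_space rho2 -> continuous q ->
  (forall x, rho2 (q x) <= rho1 x) ->
  bounded_linear_op rho1 T ->
  (forall f, calB rho1 f -> (forall y, 0 <= f y) -> forall y, 0 <= T f y) ->
  extended_le rho1 T (rho2 \o q) (fun x => C * rho2 (q x)) ->
  forall f c, calB rho2 f -> 0 <= c -> (forall y, `|f y| <= c * rho2 y) ->
  forall x, `|T (f \o q) x| <= c * C * rho2 (q x).
Proof.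
move=> wX wY cq rho_le bT T0 TC f c Bf c0 fc x.
have [p pP] := positive_op_riesz x wX bT T0.
have := TC x p pP; have [_ _ pE] := pP.
have Bfq := calB_comp wX wY cq rho_le Bf => rhoC.
have mrho : measurable_fun setT (EFin \o (rho2 \o q : borel X -> R)).
  apply/measurable_EFinP; apply: lsc_measurable => r.
  rewrite (_ : [set _ | _] = q @^-1` [set y | r < rho2 y])//.
  by apply: open_comp; [move=> z _; exact: cq|exact: open_superlevel].
have mf : measurable_fun setT (EFin \o (f \o q : borel X -> R)).
  by apply/measurable_EFinP; exact: calB_measurable Bfq.
rewrite -lee_fin -[leLHS]/(`|(T (f \o q) x)%:E|)%E pE//.
rewrite (le_trans (le_abse_integral p measurableT mf))//.
apply: (@le_trans _ _ (\int[p]_y (c%:E * (rho2 (q y))%:E))%E).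
  apply: ge0_le_integral => //.
  - exact: measurableT_comp.
  - exact: measurable_funeM.
  - by move=> y _; rewrite lee_fin fc.
rewrite ge0_integralZl//; last first.
  by move=> y _; rewrite lee_fin ltW// (weight_gt0 wY).
by rewrite -mulrA EFinM lee_wpmul2l// lee_fin.
Qed.

Theorem theorem2p8 (R : realType) (X : ptopologicalType) (Y : topologicalType)
  (rho1 : X -> R) (rho2 : Y -> R) (q : X -> Y)
  (P1 : R -> (X -> R) -> (X -> R)) (D : set (Y -> R)) (C : R)
  (wX : weighted_space rho1) (wY : weighted_space rho2)
  (q_cont : continuous q) (q_surj : range q = [set: Y])
  (P1_feller : generalized_feller rho1 P1)
  (rho_le : forall x, rho2 (q x) <= rho1 x)
  (D_dense : dense_subspace rho2 D)
  (D_factor : forall f t, D f -> 0 <= t ->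
    exists2 g, calB rho2 g & P1 t (f \o q) = g \o q)
  (C_ge1 : 1 <= C)
  (P1_rho2 : forall t, 0 <= t ->
    extended_le rho1 (P1 t) (rho2 \o q) (fun x => C * rho2 (q x))) :
  exists P2 : R -> (Y -> R) -> (Y -> R),
    generalized_feller rho2 P2 /\
    forall f t, calB rho2 f -> 0 <= t -> P1 t (f \o q) = P2 t f \o q.
Proof.
have [op1 id1 sg1 cvg1 _ pos1] := P1_feller.
have rho2_gt0 := weight_gt0 wY.
have C0 : 0 < C by rewrite (lt_le_trans ltr01).
have comp f : calB rho2 f -> calB rho1 (f \o q) by exact: calB_comp.
have dom t f c x : 0 <= t -> calB rho2 f -> 0 <= c ->
    (forall y, `|f y| <= c * rho2 y) ->
    `|P1 t (f \o q) x| <= c * C * rho2 (q x).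
  move=> t0 Bf c0 fc.
  apply: (domination_pullback wX wY q_cont rho_le (op1 t t0) _ _ Bf c0 fc).
  - by move=> g Bg g0; exact: pos1.
  - exact: P1_rho2.
have /choice[s qs] : forall y, exists x, q x = y.
  by move=> y; have : range q y by [rewrite q_surj]; move=> [x _ <-]; exists x.
have sub t f g : 0 <= t -> calB rho2 f -> calB rho2 g -> forall x,
    P1 t ((fun y => f y - g y) \o q) x = P1 t (f \o q) x - P1 t (g \o q) x.
  move=> t0 Bf Bg x; have [_ lin _] := op1 t t0.
  have := lin (-1) _ _ (comp _ Bg) (comp _ Bf) => /(congr1 (@^~ x)) /=.
  rewrite mulN1r addrC => <-; congr (P1 t _ x).
  by apply/funext => z /=; rewrite mulN1r addrC.
(* The factorization is given on D only; domination by rho2 \o q carries it to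
   the closure of D, first in this approximate form. *)
have approx t f e : 0 <= t -> calB rho2 f -> 0 < e -> exists2 g, calB rho2 g &
    forall x, `|P1 t (f \o q) x - g (q x)| <= e * rho2 (q x).
  move=> t0 Bf e0; have [DB _ /(_ _ Bf)[_ fD]] := D_dense.
  have [d [Dd Bd fd]] := fD (e / C) (divr_gt0 e0 C0).
  have [g Bg dg] := D_factor d t Dd t0; exists g => // x.
  have Bd' := DB _ Dd.
  have -> : g (q x) = P1 t (d \o q) x by rewrite dg.
  rewrite -sub// -[e in leRHS](divfK (lt0r_neq0 C0)).
  have Bfd : calB rho2 (fun y => f y - d y).
    rewrite (_ : (fun _ => _) = (fun y => (-1) * d y + f y)).
      exact: calB_lin.
    by apply/funext => y; rewrite mulN1r addrC.
  apply: dom => //; first by rewrite ltW// divr_gt0.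
  move=> y; rewrite (le_trans (le_wnorm rho2_gt0 y (calB_Brho Bfd)))//.
  by rewrite ler_pM2r// ltW.
(* s is an arbitrary section of q; factor shows that the choice is immaterial. *)
pose P2 t (f : Y -> R) := P1 t (f \o q) \o s.
have factor f t : calB rho2 f -> 0 <= t -> P1 t (f \o q) = P2 t f \o q.
  move=> Bf t0; apply/funext => x /=; apply/eqP; rewrite -subr_eq0 -normr_le0.
  apply/ler_addgt0Pr => e e0; rewrite add0r.
  have [|g _ gP] := approx t f (e / 2 / rho2 (q x)) t0 Bf.
    by rewrite !divr_gt0.
  have h1 := gP x; have h2 := gP (s (q x)).
  rewrite qs in h2; rewrite divfK ?gt_eqF// in h1 h2.
  rewrite /P2/= -(subrKA (g (q x))) (le_trans (ler_normD _ _))// (splitr e).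
  by rewrite lerD// distrC.
have P2B t f : 0 <= t -> calB rho2 f -> calB rho2 (P2 t f).
  move=> t0 Bf; apply: calB_closed => // e e0.
  have [g Bg gP] := approx t f e t0 Bf e0; exists g => // y.
  by have := gP (s y); rewrite qs.
have P2norm t f : 0 <= t -> calB rho2 f ->
    wnorm rho2 (P2 t f) <= C * wnorm rho2 f.
  move=> t0 Bf; apply: wnorm_le => // [|y].
    by rewrite mulr_ge0 ?(ltW C0)// wnorm_ge0.
  rewrite /P2/= -{2}(qs y) (mulrC C); apply: dom => //; first exact: wnorm_ge0.
  by move=> z; apply: le_wnorm => //; exact: calB_Brho.
exists P2; split; last by [].
split.
- move=> t t0; split; first by move=> f; exact: P2B.
    move=> a f g Bf Bg; have [_ lin _] := op1 t t0.
    apply/funext => y.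
    exact: (congr1 (@^~ (s y)) (lin a _ _ (comp _ Bf) (comp _ Bg))).
  by exists C => f; exact: P2norm.
- by move=> f Bf; rewrite /P2 id1; [apply/funext => y /=; rewrite qs|exact: comp].
- move=> t u t0 u0 f Bf.
  rewrite /P2 sg1//; last exact: comp.
  exact: (congr1 (fun h => P1 t h \o s) (factor _ _ Bf u0)).
- move=> f y Bf; rewrite -{2}(qs y).
  exact: (cvg1 (f \o q) (s y) (comp _ Bf)).
- exists C, 1; split => // t /andP[t0 _]; apply: ge_sup.
    exists (wnorm rho2 (P2 t (fun=> 0))), (fun=> 0) => //; split.
      exact: Cb_calB (Cb_cst 0).
    by apply: wnorm_le => // y; rewrite normr0 mul1r ltW.
  move=> _ [f [Bf f1] <-]; rewrite (le_trans (P2norm _ _ t0 Bf))//.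
  by rewrite -[leRHS]mulr1 ler_pM2l.
- move=> t f t0 Bf f0 y; by apply: (pos1 t _ t0 (comp _ Bf)) => x; exact: f0.
Qed.
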